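(* Let $q=2^t$ with $t\ge 4$ an integer, and put $n=q+1$ and $a=\frac q2$. Then for every integer $i$ with $3\le i\le a-1$ there exists an asymmetric quantum convolutional code with parameters $[(n,\ 2i-4,\ \mu^*;\ 6,\ (d_z)_f/(d_x)_f)]_q$, for some memory $\mu^*$, where $(d_z)_f\ge n-2i-1$ and $(d_x)_f\ge 3$ (with these two lower bounds interchanged if $3>n-2i-1$).
   Context: Convolutional notions. A matrix over $\mathbb F_q[D]$ is basic if it has a polynomial right inverse. The weight of $\mathbf v(D)\in\mathbb F_q[D]^n$ is the total number of nonzero coefficients of its $n$ components. The Euclidean dual of a submodule $V\subseteq\mathbb F_q[D]^n$ is $V^\perp=\{\mathbf u(D)\in\mathbb F_q[D]^n:\ \mathbf u(D)\mathbf v(1/D)^t=0\ \text{for all }\mathbf v(D)\in V\}$. Asymmetric quantum convolutional code (AQCC), CSS type. It is specified by a basic (hence full-rank) stabilizer matrix $$S(D)=\begin{pmatrix}A(D)&|&0\\0&|&B(D)\end{pmatrix},\quad A\in\mathbb F_q[D]^{r\times n},\ B\in\mathbb F_q[D]^{s\times n},\quad A(D)B(1/D)^t=0$$ (symplectic orthogonality). Let $\mathcal A,\mathcal B\subseteq\mathbb F_q[D]^n$ be the row modules of $A$ and $B$; then $\mathcal A\subseteq\mathcal B^\perp$ and $\mathcal B\subseteq\mathcal A^\perp$. The code has parameters $[(n,K,\mu^*;\gamma,(d_z)_f/(d_x)_f)]_q$, where: $n$ is the frame size; $K=n-r-s$ is the number of logical qudits per frame; $\mu^*$ is the memory, i.e.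 the maximal degree of an entry of $S(D)$; $\gamma$ is the degree, i.e. the overall constraint length (sum over the rows of $S(D)$ of the maximal degree in the row), required to be minimal among all basic matrices with the same row module; and, with $\operatorname{wt}(T)$ denoting the minimum weight of an element of $T$, $(d_z)_f$ and $(d_x)_f$ are respectively the maximum and the minimum of the two numbers $\operatorname{wt}(\mathcal B^\perp\setminus\mathcal A)$ and $\operatorname{wt}(\mathcal A^\perp\setminus\mathcal B)$. Convention: whenever the value (bound) given for $(d_x)_f$ is larger than the one given for $(d_z)_f$, the two are interchanged. Writing $\mu^*$ means that no claim is made about the value of the memory. *)

(* Defs.v *)
From HB Require Import structures.
From mathcomp Require Import all_boot all_order all_algebra.

Set Implicit Arguments.
Unset Strict Implicit.
Unset Printing Implicit Defensive.

Import GRing.Theory.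
Local Open Scope ring_scope.

Section Convolutional.

Variable F : finFieldType.

Definition pdeg (p : {poly F}) : nat := (size p).-1.

Definition polyfrac (p : {poly F}) : {fraction {poly F}} := tofrac p.

(* p(1/D), as an element of the field of fractions F(D) of F[D], where 'X
   plays the role of D. *)
Definition eval_inv (p : {poly F}) : {fraction {poly F}} :=
  (map_poly (fun c : F => polyfrac c%:P) p).[(polyfrac 'X)^-1].

(* U(D) V(1/D)^t, computed over F(D). *)
Definition mul_inv_tr (k m n : nat) (U : 'M[{poly F}]_(k, n))
    (V : 'M[{poly F}]_(m, n)) : 'M[{fraction {poly F}}]_(k, m) :=
  map_mx polyfrac U *m (map_mx eval_inv V)^T.

Definition basic (m n : nat) (M : 'M[{poly F}]_(m, n)) : Prop :=
  exists R : 'M[{poly F}]_(n, m), M *m R = 1%:M.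

Definition row_module (m n : nat) (M : 'M[{poly F}]_(m, n))
    (v : 'rV[{poly F}]_n) : Prop :=
  exists x : 'rV[{poly F}]_m, v = x *m M.

Definition euclidean_dual (n : nat) (V : 'rV[{poly F}]_n -> Prop)
    (u : 'rV[{poly F}]_n) : Prop :=
  forall v, V v -> mul_inv_tr u v = 0.

Definition wt (n : nat) (v : 'rV[{poly F}]_n) : nat :=
  (\sum_(j < n) count (fun c : F => c != 0%R) (v ord0 j))%N.

(* In particular T is nonempty. *)
Definition is_min_wt (n : nat) (T : 'rV[{poly F}]_n -> Prop) (d : nat) : Prop :=
  (exists2 v, T v & wt v = d) /\ (forall v, T v -> (d <= wt v)%N).

Definition memory (m n : nat) (M : 'M[{poly F}]_(m, n)) : nat :=
  (\max_(i < m) \max_(j < n) pdeg (M i j))%N.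

Definition constraint_length (m n : nat) (M : 'M[{poly F}]_(m, n)) : nat :=
  (\sum_(i < m) \max_(j < n) pdeg (M i j))%N.

Definition min_constraint_length (m n : nat) (M : 'M[{poly F}]_(m, n)) : Prop :=
  forall (m' : nat) (M' : 'M[{poly F}]_(m', n)),
    basic M' -> (forall v, row_module M' v <-> row_module M v) ->
    (constraint_length M <= constraint_length M')%N.

Definition css_stabilizer (n r s : nat) (A : 'M[{poly F}]_(r, n))
    (B : 'M[{poly F}]_(s, n)) : 'M[{poly F}]_(r + s, n + n) :=
  block_mx A 0 0 B.

Record is_AQCC (n r s : nat) (A : 'M[{poly F}]_(r, n))
    (B : 'M[{poly F}]_(s, n)) : Prop := IsAQCC {
  AQCC_basic : basic (css_stabilizer A B);
  AQCC_orthogonal : mul_inv_tr A B = 0;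
  AQCC_minimal : min_constraint_length (css_stabilizer A B)
}.

(* K = n - r - s is written additively to avoid truncated subtraction; for a
   code, r + s <= n holds automatically. *)
Record AQCC_params (n r s : nat) (A : 'M[{poly F}]_(r, n))
    (B : 'M[{poly F}]_(s, n)) (K mu gamma dz dx : nat) : Prop := AQCCParams {
  AQCC_logical : n = (K + r + s)%N;
  AQCC_memory : memory (css_stabilizer A B) = mu;
  AQCC_degree : constraint_length (css_stabilizer A B) = gamma;
  AQCC_distances : exists d1 d2 : nat,
    [/\ is_min_wt (fun v => euclidean_dual (row_module B) v /\
                            ~ row_module A v) d1,
        is_min_wt (fun v => euclidean_dual (row_module A) v /\
                            ~ row_module B v) d2,
        dz = maxn d1 d2 & dx = minn d1 d2]
}.

Definition exists_AQCC (n K mu gamma dz dx : nat) : Prop :=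
  exists (r s : nat) (A : 'M[{poly F}]_(r, n)) (B : 'M[{poly F}]_(s, n)),
    is_AQCC A B /\ AQCC_params A B K mu gamma dz dx.

End Convolutional.

(* Lower bounds bz for (d_z)_f and bx for (d_x)_f, interchanged if bx > bz. *)
Definition distance_bounds (bz bx dz dx : nat) : Prop :=
  if (bx <= bz)%N then (bz <= dz)%N /\ (bx <= dx)%N
  else (bx <= dz)%N /\ (bz <= dx)%N.

(* Main.v *)
(* On the q + 1 points of the projective line, forms of complementary degrees d
   and q - 1 - d are orthogonal. Take A constant, spanned by the forms of degree
   2, and B built from forms of degree q - 3: with m = q - 2i, its constant rows
   are the monomials with exponents 0, ..., m - 1 and q - 3, and its last row is
   x^m + D^6 x^(m+1). The constant rows alone bound the weights:
   a nonzero coefficient vector of an element of a dual is orthogonal to them,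
   so the interpolation argument for Reed-Solomon codes applies. The degree 6 is
   minimal because the stabilizer times a suitable constant matrix has
   determinant D^6, and stabilizers of the same row module differ by a
   unimodular factor. *)
Require Import Defs.
From HB Require Import structures.
From Stdlib Require Import Classical.
From mathcomp Require Import all_boot all_order all_algebra all_field.
From mathcomp Require Import zify.

Import GRing.Theory.

Section ConvolutionalCodes.

Set Implicit Arguments.
Unset Strict Implicit.

Local Open Scope ring_scope.

Variable F : finFieldType.

(** * Substitution of 1/D and Euclidean duals *)

HB.instance Definition _ := GRing.RMorphism.copy (@polyfrac F) (@tofrac {poly F}).
HB.instance Definition _ := GRing.RMorphism.copy (@eval_inv F)
  (horner_eval (polyfrac 'X)^-1 \o map_poly (@tofrac {poly F} \o polyC)).

Local Notation C := (map_mx (@polyC F)).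

Lemma polyfrac_inj : injective (@polyfrac F).
Proof.
move=> p q /eqP; rewrite -subr_eq0 -rmorphB /= /polyfrac tofrac_eq0 subr_eq0.
by move/eqP.
Qed.

Lemma eval_invC (c : F) : eval_inv c%:P = polyfrac c%:P.
Proof.
have -> : eval_inv c%:P = (map_poly (@tofrac {poly F} \o polyC) c%:P).[(polyfrac 'X)^-1] by [].
by rewrite map_polyC /= hornerC.
Qed.

Lemma map_eval_invC m n (M : 'M[F]_(m, n)) :
  map_mx (@eval_inv F) (C M) = map_mx (@polyfrac F) (C M).
Proof. by apply/matrixP => i j; rewrite !mxE eval_invC. Qed.

Lemma mul_inv_tr_mulmxr k l m n (U : 'M[{poly F}]_(k, n)) (X : 'M_(l, m))
    (V : 'M_(m, n)) :
  mul_inv_tr U (X *m V) = mul_inv_tr U V *m (map_mx (@eval_inv F) X)^T.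
Proof. by rewrite /mul_inv_tr map_mxM trmx_mul mulmxA. Qed.

Lemma mul_inv_trC k m n (U : 'M[{poly F}]_(k, n)) (V : 'M[F]_(m, n)) :
  mul_inv_tr U (C V) = map_mx (@polyfrac F) (U *m C V^T).
Proof. by rewrite /mul_inv_tr map_eval_invC map_mxM !map_trmx. Qed.

(** Constants are fixed by the substitution of 1/D, so orthogonality to a constant matrix is an
    equation over F[D] itself. *)
Lemma mul_inv_trC_eq0 k m n (U : 'M[{poly F}]_(k, n)) (V : 'M[F]_(m, n)) :
  mul_inv_tr U (C V) = 0 <-> U *m C V^T = 0.
Proof.
rewrite mul_inv_trC; split=> [/matrixP UV0|->]; last exact: map_mx0.
apply/matrixP => i j; apply: polyfrac_inj.
by have := UV0 i j; rewrite !mxE rmorph0.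
Qed.

Lemma row_module_row m n (M : 'M[{poly F}]_(m, n)) i : row_module M (row i M).
Proof. by exists (delta_mx ord0 i); rewrite -rowE. Qed.

Lemma euclidean_dual_row_module m n (M : 'M[{poly F}]_(m, n)) u :
  euclidean_dual (row_module M) u <-> mul_inv_tr u M = 0.
Proof.
split=> [uM|uM v [x ->]]; last by rewrite mul_inv_tr_mulmxr uM mul0mx.
apply/rowP => j; have /rowP/(_ ord0) := uM _ (row_module_row M j).
by rewrite !mxE => {2}<-; apply: eq_bigr => k _; rewrite !mxE.
Qed.

Lemma row_module_sub m m' n (M : 'M[{poly F}]_(m, n)) (M' : 'M_(m', n)) :
  (forall v, row_module M v -> row_module M' v) -> exists Y, M = Y *m M'.
Proof.
move=> sMM'.
have /fin_all_exists[y yE] : forall i, exists x, row i M = x *m M'.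
  by move=> i; apply/sMM'/row_module_row.
exists (\matrix_i y i); apply/row_matrixP => i.
by rewrite row_mul rowK.
Qed.

(** * Determinant degrees and the constraint length *)

Lemma pdeg_le (p : {poly F}) d : (pdeg p <= d)%N = (size p <= d.+1)%N.
Proof. by rewrite /pdeg; case: (size p). Qed.

Lemma size_prod_le (I : finType) (f : I -> {poly F}) (d : I -> nat) :
  (forall i, size (f i) <= (d i).+1)%N ->
  (size (\prod_i f i)%R <= (\sum_i d i).+1)%N.
Proof.
move=> fd; apply: (big_ind2 (fun (p : {poly F}) e => size p <= e.+1)%N).
- by rewrite size_poly1.
- move=> p a q b pa qb; apply: leq_trans (size_polyMleq _ _) _; lia.
- by [].
Qed.

Lemma size_sum_le (I : finType) (f : I -> {poly F}) d :
  (forall i, size (f i) <= d)%N -> (size (\sum_i f i)%R <= d)%N.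
Proof.
by move=> fd; apply: leq_trans (size_sum _ _ _) _; apply/bigmax_leqP.
Qed.

(** Each term of the Leibniz expansion takes one entry from every row. *)
Lemma size_det_le m (M : 'M[{poly F}]_m) (d : 'I_m -> nat) :
  (forall i j, size (M i j) <= (d i).+1)%N ->
  (size (\det M) <= (\sum_i d i).+1)%N.
Proof.
move=> Md; apply: size_sum_le => s.
by rewrite mulr_sign; case: ifP => _; rewrite ?size_polyN; apply: size_prod_le.
Qed.

Lemma size_det_mulC m n (M : 'M[{poly F}]_(m, n)) (W : 'M[F]_(n, m)) :
  (size (\det (M *m C W)) <= (constraint_length M).+1)%N.
Proof.
apply: size_det_le => i j; rewrite mxE; apply: size_sum_le => k.
rewrite mxE mulrC mul_polyC.
apply: leq_trans (size_scale_leq _ _) _.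
rewrite -pdeg_le.
exact: (leq_bigmax (F := fun j => pdeg (M i j))).
Qed.

(* Two basic matrices with the same row module differ by a unimodular factor,
   and for such a matrix every determinant of [M *m W] with [W] constant (a
   combination of maximal minors) has degree at most the constraint length. *)
Lemma basic_constraint_length_ge m m' n (M : 'M[{poly F}]_(m, n))
    (M' : 'M_(m', n)) (W : 'M[F]_(n, m)) :
  basic M -> basic M' -> (forall v, row_module M' v <-> row_module M v) ->
  (size (\det (M *m C W)) <= (constraint_length M').+1)%N.
Proof.
move=> [R MR] [R' MR'] MM'.
have [Y MY] : exists Y, M = Y *m M' by apply: row_module_sub => v /MM'.
have [X MX] : exists X, M' = X *m M by apply: row_module_sub => v /MM'.
have YX : Y *m X = 1%:M by rewrite -[Y *m X]mulmx1 -MR !mulmxA -(mulmxA Y) -MX -MY.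
have XY : X *m Y = 1%:M by rewrite -[X *m Y]mulmx1 -MR' !mulmxA -(mulmxA X) -MY -MX.
have mE : m' = m by apply/eqP; rewrite eqn_leq (mulmx1_min XY) (mulmx1_min YX).
case: m / mE in M W R MR MM' Y X MY MX YX XY *.
rewrite MY -mulmxA det_mulmx.
have Yunit : \det Y \is a GRing.unit.
  by apply/unitrP; exists (\det X); rewrite -!det_mulmx YX XY det1.
move: Yunit; rewrite poly_unitE => /andP[/eqP Ysize _].
apply: leq_trans (size_polyMleq _ _) _.
by rewrite Ysize addSn add0n /=; apply: size_det_mulC.
Qed.

Lemma constraint_length_block r s n1 n2 (A : 'M[{poly F}]_(r, n1))
    (B : 'M[{poly F}]_(s, n2)) :
  constraint_length (block_mx A 0 0 B) = (constraint_length A + constraint_length B)%N.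
Proof.
have pdeg0 : pdeg (0 : {poly F}) = 0%N by rewrite /pdeg size_poly0.
rewrite /constraint_length big_split_ord; congr (_ + _)%N; apply: eq_bigr => i _;
  rewrite big_split_ord /=.
- rewrite [X in maxn _ X]big1 ?maxn0; last by move=> j _; rewrite block_mxEur mxE.
  by apply: eq_bigr => j _; rewrite block_mxEul.
- rewrite [X in maxn X _]big1 ?max0n; last by move=> j _; rewrite block_mxEdl mxE.
  by apply: eq_bigr => j _; rewrite block_mxEdr.
Qed.

Lemma constraint_length_col r s n (A : 'M[{poly F}]_(r, n)) (B : 'M[{poly F}]_(s, n)) :
  constraint_length (col_mx A B) = (constraint_length A + constraint_length B)%N.
Proof.
rewrite /constraint_length big_split_ord; congr (_ + _)%N; apply: eq_bigr => i _;
  by apply: eq_bigr => j _; rewrite ?col_mxEu ?col_mxEd.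
Qed.

Lemma constraint_lengthC m n (M : 'M[F]_(m, n)) : constraint_length (C M) = 0%N.
Proof.
rewrite /constraint_length big1 // => i _; rewrite big1 // => j _.
by rewrite mxE /pdeg size_polyC; case: eqP.
Qed.

(** * Stabilizers with a single nonconstant row *)

Lemma row_freeC_rinv m n (M : 'M[F]_(m, n)) :
  row_free M -> exists R : 'M[F]_(n, m), C M *m C R = 1%:M.
Proof.
move=> /row_freeP[R MR]; exists R.
by rewrite -map_mxM; move: MR => /= ->; rewrite map_mx1.
Qed.

(** All dependence on D sits in this factor, which merges the last two rows [b] and [c] into b + D^g
    c; orthogonality and right inverses thus reduce to constant matrices. *)
Definition mixing s g : 'M[{poly F}]_(s + 1, s + (1 + 1)) :=
  block_mx 1%:M 0 0 (row_mx 1%:M ('X^g)%:M).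

Definition lifted_mx s n (E : 'M[F]_(s, n)) (b c : 'rV[F]_n) g : 'M[{poly F}]_(s + 1, n) :=
  mixing s g *m C (col_mx E (col_mx b c)).

Lemma lifted_mxE s n (E : 'M[F]_(s, n)) b c g :
  lifted_mx E b c g = col_mx (C E) (C b + 'X^g *: C c).
Proof.
rewrite /lifted_mx /mixing !map_col_mx mul_block_col mul_row_col !mul1mx !mul0mx.
by rewrite addr0 add0r mul_scalar_mx.
Qed.

Lemma constraint_length_lifted s n (E : 'M[F]_(s, n)) b c g :
  (constraint_length (lifted_mx E b c g) <= g)%N.
Proof.
rewrite lifted_mxE constraint_length_col constraint_lengthC add0n.
rewrite /constraint_length big_ord1; apply/bigmax_leqP => j _.
rewrite pdeg_le !mxE.
apply: leq_trans (size_polyD _ _) _; rewrite geq_max; apply/andP; split.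
  by apply: leq_trans (size_polyC_leq1 _) _.
by rewrite mulrC mul_polyC; apply: leq_trans (size_scale_leq _ _) _; rewrite size_polyXn.
Qed.

Section CSSCode.

Variables (r s n g : nat) (A0 : 'M[F]_(r, n)) (E : 'M[F]_(s, n)) (b c : 'rV[F]_n).

Let M0 := col_mx E (col_mx b c).
Let A := C A0.
Let B := lifted_mx E b c g.

Hypothesis A0_free : row_free A0.
Hypothesis M0_free : row_free M0.
Hypothesis A0M0 : A0 *m M0^T = 0.

Lemma css_lifted_basic : basic (css_stabilizer A B).
Proof.
have [RA RAE] := row_freeC_rinv A0_free; have [RM RME] := row_freeC_rinv M0_free.
(* [col_mx 1%:M 0] selects the coefficient 1 of [b] in the last row of [mixing]. *)
exists (block_mx (C RA) 0 0 (C RM *m block_mx 1%:M 0 0 (col_mx 1%:M 0))).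
rewrite mulmx_block !mulmx0 !mul0mx !addr0 !add0r /A RAE.
rewrite /B /lifted_mx -/M0 mulmxA -(mulmxA (mixing s g)) RME mulmx1.
rewrite mulmx_block !mulmx0 !mul0mx !addr0 !add0r mul_row_col !mulmx1 mulmx0 addr0.
by rewrite -!scalar_mx_block.
Qed.

(* [W] inverts the constant part and selects the coefficient of ['X^g]. *)
Lemma css_lifted_det :
  exists W : 'M[F]_(n + n, r + (s + 1)), \det (css_stabilizer A B *m C W) = 'X^g.
Proof.
have [RA RAE] := row_freeC_rinv A0_free; have [RM RME] := row_freeC_rinv M0_free.
exists (block_mx RA 0 0 (RM *m block_mx 1%:M 0 0 (col_mx 0 1%:M))).
rewrite map_block_mx !map_mx0 map_mxM mulmx_block !mulmx0 !mul0mx !addr0 !add0r.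
rewrite /A RAE /B /lifted_mx -/M0 mulmxA -(mulmxA (mixing s g)).
rewrite RME mulmx1 map_block_mx !map_mx0 map_col_mx map_mx0 !map_mx1.
rewrite mulmx_block !mulmx0 !mul0mx !addr0 !add0r mul_row_col !mulmx1 mulmx0 add0r.
by rewrite !det_ublock !det1 !mul1r det_scalar expr1.
Qed.

Lemma css_lifted_constraint_length_ge m' (S : 'M[{poly F}]_(m', n + n)) :
  basic S -> (forall v, row_module S v <-> row_module (css_stabilizer A B) v) ->
  (g <= constraint_length S)%N.
Proof.
have [W WE] := css_lifted_det => Sb SAB.
have := basic_constraint_length_ge W css_lifted_basic Sb SAB.
by rewrite WE size_polyXn.
Qed.

Lemma css_lifted_constraint_length : constraint_length (css_stabilizer A B) = g.
Proof.
apply/eqP; rewrite eqn_leq css_lifted_constraint_length_ge ?andbT //; last first.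
  exact: css_lifted_basic.
by rewrite constraint_length_block constraint_lengthC constraint_length_lifted.
Qed.

Lemma css_lifted_is_AQCC : is_AQCC A B.
Proof.
split; first exact: css_lifted_basic.
  rewrite /B /lifted_mx mul_inv_tr_mulmxr.
  suff -> : mul_inv_tr A (C M0) = 0 by rewrite mul0mx.
  by apply/mul_inv_trC_eq0; rewrite -map_mxM A0M0 map_mx0.
by move=> m' M' /css_lifted_constraint_length_ge; rewrite css_lifted_constraint_length; apply.
Qed.

(** Shows that the set defining the second distance is nonempty. *)
Lemma last_row_mem_dual : euclidean_dual (row_module A) (C c) /\ ~ row_module B (C c).
Proof.
split.
  apply/euclidean_dual_row_module/mul_inv_trC_eq0; rewrite -map_mxM.
  suff -> : c *m A0^T = 0 by rewrite map_mx0.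
  move: A0M0; rewrite /M0 !tr_col_mx !mul_mx_row -[0]hsubmxK => /eq_row_mx[_].
  rewrite -[rsubmx _]hsubmxK => /eq_row_mx[_ Ac].
  by apply: trmx_inj; rewrite trmx_mul trmxK Ac !linear0.
move=> [x cx]; have [RM RME] := row_freeC_rinv M0_free.
(* Compare coordinates in the free rows of [M0]: that of [b] makes the last entry of [x] zero, and
   then that of [c] reads 1 = 0. *)
have : row_mx 0 (row_mx 0 1%:M) *m C M0 = x *m mixing s g *m C M0.
  by rewrite -mulmxA -cx !map_col_mx !mul_row_col !mul0mx !add0r mul1mx.
move=> /(congr1 (mulmx^~ (C RM))) /=; rewrite -!mulmxA RME !mulmx1.
rewrite -[x]hsubmxK mul_row_block !mulmx0 !mulmx1 addr0 add0r mul_mx_row mulmx1.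
move=> /eq_row_mx[_ /eq_row_mx[<-]]; rewrite mul0mx.
by move=> /matrixP/(_ ord0 ord0); rewrite !mxE eqxx => /eqP; rewrite oner_eq0.
Qed.

End CSSCode.

(** * Weights of polynomial vectors *)

(** The coefficients of a fixed D^k in [v] form a constant vector that is still orthogonal to [N],
    and its weight is at most that of [v]. *)
Lemma wt_dual_ge m n (N : 'M[F]_(m, n)) d (v : 'rV[{poly F}]_n) :
  (forall u : 'rV[F]_n, u != 0 -> u *m N^T = 0 -> (d <= #|[set j | u ord0 j != 0%R]|)%N) ->
  mul_inv_tr v (C N) = 0 -> v != 0 -> (d <= wt v)%N.
Proof.
move=> Nd /mul_inv_trC_eq0 vN /rV0Pn[j0].
(* Taking for [k] the degree of a nonzero component makes this vector nonzero. *)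
rewrite -lead_coef_eq0 /lead_coef; set k := (size _).-1 => vk0.
pose u : 'rV[F]_n := \row_j (v ord0 j)`_k.
have u0 : u != 0 by apply/rV0Pn; exists j0; rewrite mxE.
have uN : u *m N^T = 0.
  apply/rowP => i; have /rowP/(_ i)/(congr1 (fun p : {poly F} => p`_k)) := vN.
  rewrite !mxE coef0 coef_sum => {2}<-; apply: eq_bigr => j _.
  by rewrite !mxE coefMC.
apply: leq_trans (Nd u u0 uN) _.
rewrite -sum1_card big_mkcond /=; apply: leq_sum => j _.
rewrite inE mxE; case: ifP => // vjk; rewrite -has_count.
apply/(has_nthP 0); exists k => //.
by rewrite ltnNge; apply/negP => kv; rewrite nth_default ?eqxx in vjk.
Qed.

(** Descent on the weight; since [T] is an arbitrary predicate, the existence of a lighter element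
    is decided classically. *)
Lemma is_min_wt_exists n (T : 'rV[{poly F}]_n -> Prop) v :
  T v -> exists d, is_min_wt T d.
Proof.
have [k] := ubnP (wt v); elim: k v => // k IHk v vk Tv.
have [[u Tu uv]|min_v] := classic (exists2 u, T u & (wt u < wt v)%N).
  by apply: IHk Tu; apply: leq_trans uv _.
exists (wt v); split; first by exists v.
by move=> u Tu; rewrite leqNgt; apply/negP => uv; apply: min_v; exists u.
Qed.

(** * Power sums over a finite field *)

Lemma card_natr0 : #|F|%:R = 0 :> F.
Proof.
(* Translation by 1 permutes the field. *)
have /eqP : \sum_(x : F) x = \sum_(x : F) x + #|F|%:R.
  rewrite [LHS](reindex (+%R^~ 1)) /=; last first.
    by exists (+%R^~ (-1)) => x _; rewrite ?addrK ?subrK.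
  by rewrite big_split /= sumr_const.
by rewrite -subr_eq0 opprD addNKr oppr_eq0 => /eqP.
Qed.

Lemma sum_expr k : (k <= #|F|.-1)%N -> \sum_(x : F) x ^+ k = - (k == #|F|.-1)%:R.
Proof.
have F1 := finNzRing_gt1 F.
rewrite leq_eqVlt => /orP[/eqP ->|kF].
  have expF (x : F) : x ^+ #|F|.-1 = (x != 0)%:R.
    have [->|x0] := eqVneq x 0; first by rewrite expr0n; case: #|F| F1 => [|[]].
    by apply: (mulfI x0); rewrite -exprS prednK ?expf_card ?mulr1 // ltnW.
  rewrite eqxx (eq_bigr _ (fun x _ => expF x)) (bigD1 0) //= eqxx add0r.
  rewrite (eq_bigr (fun=> 1)) => [|x ->//].
  have := card_natr0; rewrite -sumr_const (bigD1 0) //= => /eqP.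
  by rewrite addrC addr_eq0 => /eqP.
rewrite ltn_eqF // oppr0.
(* As [0 ^+ 0 = 1], the exponent 0 gives the sum #|F| * 1 = 0. *)
have [k0|k0] := posnP k.
  by rewrite k0 (eq_bigr (fun=> 1)) => [|x _]; rewrite ?sumr_const ?card_natr0 ?expr0.
(* X^k - 1 has at most k roots, fewer than there are nonzero elements. Scaling by such a [y]
   permutes the field and multiplies the sum by y^k. *)
have [y y0 yk] : exists2 y : F, y != 0 & y ^+ k != 1.
  apply/exists_inP; apply: contraLR kF; rewrite negb_exists_in -leqNgt.
  move=> /forall_inP yk.
  have p0 : 'X^k - 1%:P != 0 :> {poly F} by rewrite -size_poly_eq0 size_XnsubC.
  have := @max_poly_roots _ _ (enum [pred y : F | y != 0]) p0.
  rewrite size_XnsubC // -cardE -(cardC1 (0 : F)) enum_uniq ltnS; apply=> //.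
  apply/allP => y; rewrite mem_enum => /yk; rewrite negbK => /eqP yk1.
  by rewrite /root !hornerE yk1 subrr.
apply/eqP; have : (y ^+ k - 1) * \sum_(x : F) x ^+ k == 0.
  rewrite mulrBl mul1r subr_eq0 mulr_sumr [X in _ == X](reindex ( *%R y)) /=; last first.
    by exists ( *%R y^-1) => x _; rewrite ?mulKf ?mulVKf.
  by apply/eqP/eq_bigr => x _; rewrite exprMn.
by rewrite mulf_eq0 subr_eq0 (negPf yk).
Qed.

(** * Evaluation of monomials on the projective line *)

(* Row [k] evaluates the form [X^(f k) Y^(d - f k)] of degree [d] at all points
   of the projective line, the last column being the point at infinity. *)
Definition monomial_mx (d m : nat) (f : nat -> nat) : 'M[F]_(m, #|F| + 1) :=
  row_mx (\matrix_(k < m, j < #|F|) enum_val j ^+ f k) (\col_(k < m) (f k == d)%:R).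

Lemma col_monomial_mx d m1 m2 f :
  col_mx (monomial_mx d m1 f) (monomial_mx d m2 (fun k => f (m1 + k)%N)) =
  monomial_mx d (m1 + m2) f.
Proof.
rewrite /monomial_mx -block_mxEv block_mxEh.
by congr row_mx; apply/matrixP => i j; rewrite mxE; case: splitP => k ik; rewrite !mxE ik.
Qed.

(** The affine points contribute a power sum, which is -1 when both exponents are maximal and 0
    otherwise; the point at infinity contributes exactly the compensating 1. *)
Lemma monomial_mx_orthogonal (d d' m m' : nat) f f' :
  (d + d' = #|F|.-1)%N -> (forall k, (k < m)%N -> (f k <= d)%N) ->
  (forall k, (k < m')%N -> (f' k <= d')%N) ->
  monomial_mx d m f *m (monomial_mx d' m' f')^T = 0.
Proof.
move=> dd' fd f'd'; apply/matrixP => k l.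
rewrite tr_row_mx mul_row_col !mxE big_ord1 !mxE.
have fk := fd k (ltn_ord k); have fl := f'd' l (ltn_ord l).
under eq_bigr do rewrite !mxE -exprD.
rewrite -(big_enum_val (A := F) (fun x => x ^+ (f k + f' l))) sum_expr; last by lia.
apply/eqP; rewrite addrC subr_eq0 -natrM mulnb; apply/eqP; congr ((nat_of_bool _)%:R).
lia.
Qed.

(** The affine columns suffice: a polynomial of degree below #|F| that vanishes on the whole field
    is zero. *)
Lemma monomial_mx_free (d m : nat) f :
  (forall k, (k < m)%N -> (f k < #|F|)%N) ->
  (forall k l, (k < m)%N -> (l < m)%N -> f k = f l -> k = l) ->
  row_free (monomial_mx d m f).
Proof.
move=> fF f_inj; apply: inj_row_free => v.
rewrite mul_mx_row -[0]hsubmxK => /eq_row_mx[/rowP v0 _].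
pose p := \sum_(k < m) v ord0 k *: 'X^(f k).
have p0 : p = 0.
  apply/eqP; apply: contraT => /max_poly_roots roots.
  have pF : (size p <= #|F|)%N.
    apply: size_sum_le => k; apply: leq_trans (size_scale_leq _ _) _.
    by rewrite size_polyXn fF.
  have := roots (enum F); rewrite -cardE ltnNge pF enum_uniq; apply=> //.
  apply/allP => x _; apply/rootP; have := v0 (enum_rank x); rewrite !mxE => <-.
  rewrite horner_sum; apply: eq_bigr => k _.
  by rewrite !hornerE mxE enum_rankK.
apply/rowP => k; have := congr1 (fun r : {poly F} => r`_(f k)) p0.
rewrite coef_sum coef0 (bigD1 k) //= big1 => [|l lk].
  by rewrite coefZ coefXn eqxx mulr1 addr0 mxE.
rewrite coefZ coefXn; case: eqP => [/f_inj kl|]; last by rewrite mulr0.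
by case/eqP: lk; apply/val_inj; rewrite /= kl.
Qed.

Lemma wt_monomial_dual d m s f (u : 'rV[F]_(#|F| + 1)) :
  (m <= d)%N -> (forall j, (j < m)%N \/ j = d -> exists2 k, (k < s)%N & f k = j) ->
  u != 0 -> u *m (monomial_mx d s f)^T = 0 -> (m < #|[set j | u ord0 j != 0%R]|)%N.
Proof.
move=> md f_onto u0 uM; rewrite ltnNge; apply/negP => um.
pose x (j : 'I_#|F|) : F := enum_val j.
pose v := lsubmx u; pose w := rsubmx u ord0 ord0.
have uE j : (j < m)%N \/ j = d ->
    \sum_i v ord0 i * x i ^+ j + w * (j == d)%:R = 0.
  move=> /f_onto[k ks <-]; have /rowP/(_ (Ordinal ks)) := uM.
  rewrite -[u in u *m _]hsubmxK tr_row_mx mul_row_col !mxE big_ord1 !mxE => {2}<-.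
  by rewrite [w]mxE; congr (_ + _); apply: eq_bigr => i _; rewrite !mxE.
pose S := [set i | v ord0 i != 0].
have Sm : (#|S| <= m)%N.
  apply: leq_trans um; rewrite -(card_imset _ (@lshift_inj _ 1)).
  by apply/subset_leq_card/subsetP => _ /imsetP[i + ->]; rewrite !inE mxE.
(* Without affine support, the row of exponent [d] kills the coordinate at infinity. *)
have [S0|[i0 i0S]] := set_0Vmem S.
  have v0 : v = 0.
    apply/rowP => i; have := in_set0 i; rewrite -S0 inE mxE => /negbFE/eqP.
    by rewrite mxE.
  case/eqP: u0; rewrite -[u]hsubmxK -/v v0 -[0 in RHS]hsubmxK !linear0.
  congr row_mx; apply/rowP => i; rewrite ord1 [RHS]mxE.
  have := uE d (or_intror erefl); rewrite eqxx mulr1 big1 ?add0r // => j _.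
  by rewrite v0 mxE mul0r.
(* [p] vanishes on the affine support except at [i0] and has degree below [m]. The rows of exponent
   below [m], which are zero at infinity because m <= d, pair it to 0 with [v]. *)
pose p := \prod_(i in S :\ i0) ('X - (x i)%:P).
have psize : (size p <= m)%N.
  by rewrite /p -big_enum size_prod_XsubC -cardE; move: Sm; rewrite (cardsD1 i0) i0S.
have : \sum_i v ord0 i * p.[x i] = 0.
  under eq_bigr do rewrite (horner_coef_wide _ psize) mulr_sumr.
  rewrite exchange_big big1 //= => k _.
  have := uE k (or_introl (ltn_ord k)).
  rewrite ltn_eqF ?(leq_trans (ltn_ord k)) // mulr0 addr0 => uk.
  transitivity (p`_k * \sum_i v ord0 i * x i ^+ k); last by rewrite uk mulr0.
  by rewrite mulr_sumr; apply: eq_bigr => i _; rewrite mulrCA.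
rewrite (bigD1 i0) //= big1 ?addr0 => [/eqP|i ii0].
  move: i0S; rewrite inE mulf_eq0 => /negPf -> /=.
  rewrite horner_prod => /prodf_eq0[i]; rewrite !inE => /andP[ii0 _].
  rewrite hornerXsubC subr_eq0 => /eqP/enum_val_inj i0i.
  by rewrite i0i eqxx in ii0.
have [iS|] := boolP (i \in S); last by rewrite inE negbK => /eqP ->; rewrite mul0r.
rewrite [p](bigD1 i) ?inE ?ii0 //=; last by rewrite inE in iS.
by rewrite hornerM hornerXsubC subrr mul0r mulr0.
Qed.

(** * The codes and their parameters *)

Lemma exists_projective_AQCC m g : (m + 6 <= #|F|)%N ->
  exists mu d1 d2 : nat, [/\ (m < d1)%N, (2 < d2)%N &
    exists_AQCC F (#|F| + 1) (#|F| - m - 4) mu g (maxn d1 d2) (minn d1 d2)].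
Proof.
move=> mF; pose d := (#|F| - 3)%N.
(* The exponents run 0, ..., m - 1, d, m, m + 1, so [E] ends with [d], while [b] and [c] get m and m
   + 1. *)
pose f k := if (k < m)%N then k else if k == m then d else k.-1.
pose s := (m + 1)%N.
pose A0 := monomial_mx 2 3 id.
pose E := monomial_mx d s f.
pose b := monomial_mx d 1 (fun k => f (s + k)%N).
pose c := monomial_mx d 1 (fun k => f (s + (1 + k))%N).
have M0E : col_mx E (col_mx b c) = monomial_mx d (s + (1 + 1)) f.
  by rewrite -(@col_monomial_mx d s (1 + 1)) -(@col_monomial_mx d 1 1).
have f_le k : (k < s + (1 + 1))%N -> (f k <= d)%N.
  by rewrite /f /s /d => ks; case: ifP => [|_]; [|case: eqP]; lia.
have A0_free : row_free A0 by apply: monomial_mx_free => //; lia.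
have M0_free : row_free (col_mx E (col_mx b c)).
  rewrite M0E; apply: monomial_mx_free => [k /f_le|k l]; first by rewrite /d; lia.
  rewrite /f /s /d => ks ls.
  by do ?[case: ifP => ?]; lia.
have A0M0 : A0 *m (col_mx E (col_mx b c))^T = 0.
  by rewrite M0E; apply: monomial_mx_orthogonal => //; rewrite /d; lia.
pose A := map_mx (@polyC F) A0; pose B := lifted_mx E b c g.
have [d1 d1P] : exists d1, is_min_wt (fun v => euclidean_dual (row_module B) v /\
    ~ row_module A v) d1.
  (* [h] evaluates x^3 and is 0 at infinity since 3 differs from 4. It lies in the dual of [B], as 3
     + f k is either #|F|, where x^#|F| = x, or below #|F| - 1. The vector [u] of x^(d - 1), also 0
     at infinity, is orthogonal to [A0] but pairs with [h] to -1, so [h] is not in the row module of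
     [A]. *)
  pose h := monomial_mx 4 1 (fun=> 3).
  pose u := monomial_mx d 1 (fun=> d.-1).
  apply: (@is_min_wt_exists _ _ (C h)); split.
    apply/euclidean_dual_row_module; rewrite mul_inv_tr_mulmxr.
    suff -> : mul_inv_tr (C h) (C (col_mx E (col_mx b c))) = 0 by rewrite mul0mx.
    apply/mul_inv_trC_eq0; rewrite -map_mxM.
    suff -> : h *m (col_mx E (col_mx b c))^T = 0 by rewrite map_mx0.
    rewrite M0E; apply/rowP => k; rewrite tr_row_mx mul_row_col !mxE big_ord1 !mxE.
    rewrite mul0r addr0; under eq_bigr do rewrite !mxE -exprD.
    rewrite -(big_enum_val (A := F) (fun x => x ^+ (3 + f k))) /=.
    have [fkd|fkd] := eqVneq (f k) d.
      have -> : (3 + f k = #|F|)%N by rewrite fkd /d; lia.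
      rewrite (eq_bigr (fun x : F => x ^+ 1)) => [|x _]; last by rewrite expf_card.
      by rewrite sum_expr ?ltn_eqF ?oppr0 //; lia.
    suff fk : (3 + f k < #|F|.-1)%N by rewrite sum_expr ?ltn_eqF ?oppr0 // ltnW.
    move: fkd (ltn_ord k); rewrite /f /s /d.
    by do ?[case: ifP => ?]; lia.
  move=> [x hx]; have A0u : A0 *m u^T = 0.
    by apply: monomial_mx_orthogonal => //; rewrite /d; lia.
  have hu : h *m u^T = 0.
    have : C (h *m u^T) = C 0.
      by rewrite map_mxM /= hx -mulmxA -map_mxM A0u !map_mx0 mulmx0.
    by apply: map_mx_inj; apply: polyC_inj.
  have /rowP/(_ ord0) := hu; rewrite tr_row_mx mul_row_col !mxE big_ord1 !mxE.
  rewrite mul0r addr0; under eq_bigr do rewrite !mxE -exprD.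
  rewrite -(big_enum_val (A := F) (fun x => x ^+ (3 + d.-1))) /=.
  have -> : (3 + d.-1 = #|F|.-1)%N by rewrite /d; lia.
  by move/eqP; rewrite sum_expr // eqxx oppr_eq0 oner_eq0.
have [d2 d2P] : exists d2, is_min_wt (fun v => euclidean_dual (row_module A) v /\
    ~ row_module B v) d2.
  by apply: is_min_wt_exists; apply: (last_row_mem_dual g M0_free A0M0).
exists (memory (css_stabilizer A B)), d1, d2; split.
- case: d1P => -[v [Bv Av] <-] _; apply: (@wt_dual_ge _ _ E) => [w w0||].
  + apply: wt_monomial_dual => //; first by rewrite /d; lia.
    move=> j [jm|->]; [exists j | exists m]; rewrite /f /s ?jm ?ltnn ?eqxx //; lia.
  (* Only the constant rows of [B] are used for the bound. *)
  + have -> : C E = row_mx 1%:M 0 *m B.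
      by rewrite /B lifted_mxE mul_row_col mul1mx mul0mx addr0.
    by move/euclidean_dual_row_module: Bv => Bv; rewrite mul_inv_tr_mulmxr Bv mul0mx.
  + by apply/eqP => v0; apply: Av; rewrite v0; exists 0; rewrite mul0mx.
- case: d2P => -[v [Av Bv] <-] _; apply: (@wt_dual_ge _ _ A0) => [w w0||].
  (* Here both the number of initial exponents and the degree are 2. *)
  + apply: wt_monomial_dual => // j [j2|->]; last by exists 2.
    by exists j; lia.
  + exact/euclidean_dual_row_module.
  + by apply/eqP => v0; apply: Bv; rewrite v0; exists 0; rewrite mul0mx.
exists 3, (s + 1)%N, A, B; split; first exact: css_lifted_is_AQCC.
split=> //; first by rewrite /s; lia.
  exact: css_lifted_constraint_length.
by exists d1, d2.
Qed.

End ConvolutionalCodes.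

Theorem theorem3p3 (t q n a i : nat) (F : finFieldType)
    (ht : (4 <= t)%N) (hq : q = (2 ^ t)%N) (hF : #|F| = q)
    (hn : n = (q + 1)%N) (ha : a = (q %/ 2)%N)
    (hi3 : (3 <= i)%N) (hia : (i <= a - 1)%N) :
  exists mu dz dx : nat,
    exists_AQCC F n (2 * i - 4)%N mu 6 dz dx /\
    distance_bounds (n - 2 * i - 1)%N 3 dz dx.
Proof.
(* With m = q - 2i, the condition m + 6 <= q is i >= 3, and m equals n - 2i - 1. *)
have [|mu [d1 [d2 [d1_ge d2_ge code]]]] :=
  @exists_projective_AQCC F (q - 2 * i) 6; first by lia.
exists mu, (maxn d1 d2), (minn d1 d2); split.
  move: code; rewrite hF -hn.
  by have -> : q - (q - 2 * i) - 4 = 2 * i - 4 by lia.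
by rewrite /distance_bounds; case: ifP; lia.
Qed.
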